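(* Let $n\ge 2$ be an integer. Then $\overline{M}_n$ is a noncommutative inverse monoid with zero $\mathbf{0}$, whose identity is $\mathbf{1}=\prec 1,0,n\succ$. For every $x\in\overline{M}_n$, the element $x^T$ is the unique (semigroup) inverse of $x$. The semilattice $\mathbf{E}(\overline{M}_n)$ of idempotents of $\overline{M}_n$ consists of $\mathbf{0}$ together with all elements of $\overline{M}_n$ of the form $\prec k,0,m\succ$ (i.e. the nonzero elements $\prec k,d,m\succ$ with $d=0$).
   Context: For an integer $n\ge 2$, $\overline{M}_n$ is the set consisting of an element $\mathbf{0}$ together with all triplets $\prec k,d,m\succ$ of real numbers $k,d,m$ satisfying $1-\min(0,d)\le k\le m\le n-\max(0,d)$. (Distinct triplets are distinct elements, all different from $\mathbf{0}$.) Multiplication on $\overline{M}_n$: $\mathbf{0}x=x\mathbf{0}=\mathbf{0}$ for all $x$, and for nonzero elements, $\prec k,d,m\succ\prec k',d',m'\succ$ equals $\prec k'',d'',m''\succ$ if $k''\le m''$ and equals $\mathbf{0}$ if $k''>m''$, where $k''=\max(k,k'-d)$, $d''=d+d'$, $m''=\min(m,m'-d)$. Define $x^T$ by $\mathbf{0}^T=\mathbf{0}$ and $\prec k,d,m\succ^T=\prec k+d,-d,m+d\succ$. A semigroup inverse of $x$ is an element $y$ with $xyx=x$ and $yxy=y$; an inverse semigroup is a semigroup in which every element has exactly one inverse. *)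

(* Defs.v *)
From mathcomp Require Import all_boot all_order all_algebra.
From mathcomp Require Import ring lra.
From mathcomp Require Import all_classical reals.

Set Implicit Arguments.
Unset Strict Implicit.
Unset Printing Implicit Defensive.

Import Order.TTheory GRing.Theory Num.Theory.
Local Open Scope classical_set_scope.
Local Open Scope ring_scope.

Definition is_identity (T : Type) (mul : T -> T -> T) (e : T) : Prop :=
  left_id e mul /\ right_id e mul.

Definition is_zero (T : Type) (mul : T -> T -> T) (z : T) : Prop :=
  left_zero z mul /\ right_zero z mul.

Definition is_monoid (T : Type) (mul : T -> T -> T) (e : T) : Prop :=
  associative mul /\ is_identity mul e.

Definition inverse_of (T : Type) (mul : T -> T -> T) (x y : T) : Prop :=
  mul (mul x y) x = x /\ mul (mul y x) y = y.

Definition is_inverse_semigroup (T : Type) (mul : T -> T -> T) : Prop :=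
  associative mul /\ forall x, exists! y, inverse_of mul x y.

Definition idempotents (T : Type) (mul : T -> T -> T) : set T :=
  [set x | mul x x = x].

Definition is_semilattice_on (T : Type) (mul : T -> T -> T) (A : set T) : Prop :=
  [/\ forall x y, A x -> A y -> A (mul x y),
      forall x y z, A x -> A y -> A z -> mul x (mul y z) = mul (mul x y) z,
      forall x y, A x -> A y -> mul x y = mul y x
    & forall x, A x -> mul x x = x].

Definition in_range (R : realType) (n : nat) (k d m : R) : bool :=
  [&& 1 - Num.min 0 d <= k, k <= m & m <= n%:R - Num.max 0 d].

(* The range condition is boolean, hence proof-irrelevant: two nonzero elements
   are equal if and only if their three coordinates are. *)
Inductive Mbar (R : realType) (n : nat) : Type :=
| Zero
| Triplet (k d m : R) of in_range n k d m.

Arguments Zero {R n}.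
Arguments Triplet {R n k d m} _.

Section Operations.
Variables (R : realType) (n : nat).
Implicit Types k d m : R.

Lemma in_range_mul k d m k' d' m' :
  in_range n k d m -> in_range n k' d' m' ->
  Num.max k (k' - d) <= Num.min m (m' - d) ->
  in_range n (Num.max k (k' - d)) (d + d') (Num.min m (m' - d)).
Proof.
rewrite /in_range => /and3P[h1 h2 h3] /and3P[h4 h5 h6] ->.
by apply/and3P; split=> //; move: h1 h3 h4 h6;
  rewrite !minEle !maxEle; do !case: ifP; lra.
Qed.

Lemma in_range_tr k d m :
  in_range n k d m -> in_range n (k + d) (- d) (m + d).
Proof.
rewrite /in_range => /and3P[h1 h2 h3]; apply/and3P.
by split; move: h1 h2 h3; rewrite ?minEle ?maxEle; do ?case: ifP; lra.
Qed.

Lemma in_range_one : (2 <= n)%N -> in_range n (1 : R) 0 n%:R.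
Proof.
move=> hn; rewrite /in_range minxx maxxx !subr0 !lexx /= andbT ler1n.
exact: ltnW.
Qed.

Definition Mbar_mul (x y : Mbar R n) : Mbar R n :=
  match x, y with
  | Triplet k d m h, Triplet k' d' m' h' =>
      match decP (@idP (Num.max k (k' - d) <= Num.min m (m' - d))) with
      | left hle => Triplet (in_range_mul h h' hle)
      | right _ => Zero
      end
  | _, _ => Zero
  end.

Definition Mbar_tr (x : Mbar R n) : Mbar R n :=
  match x with
  | Zero => Zero
  | Triplet _ _ _ h => Triplet (in_range_tr h)
  end.

Definition Mbar_one (hn : (2 <= n)%N) : Mbar R n := Triplet (in_range_one hn).

End Operations.

Arguments Mbar_mul {R n} x y.
Arguments Mbar_tr {R n} x.
Arguments Mbar_one R {n} hn.

(* Main.v *)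
Require Import Defs.
From mathcomp Require Import all_boot all_order all_algebra.
From mathcomp Require Import lra.
From mathcomp Require Import all_classical reals.

Set Implicit Arguments.
Unset Strict Implicit.
Unset Printing Implicit Defensive.

Import Order.TTheory GRing.Theory Num.Theory.
Local Open Scope classical_set_scope.
Local Open Scope ring_scope.

(** A triplet [Triplet k d m] stands for the translation [s |-> s + d] with
    domain the interval from [k] to [m]; the range condition says that this
    interval is nonempty and that it and its image lie between [1] and [n].
    The element [Zero] stands for the empty map.  Under this reading
    multiplication is composition of partial maps, applied from left to right
    ([graph_mul]), [Mbar_tr] is the inverse partial map ([graph_tr]), and
    distinct elements have distinct graphs ([graph_inj]): a nonempty interval
    determines its endpoints, and any of its points determines the shift.

    Every claim thereby becomes one about composition of partial injections.
    Associativity is inherited from composition of relations.  If [y] is an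
    inverse of [x] and [x] sends [s] to [t], then following [x], [y], [x] from
    [s] must end at [t], and injectivity of [x] forces [y] to send [t] to [s];
    by symmetry the graph of [y] is the converse of that of [x]
    ([inverse_graph]).  If [x] is idempotent and sends [s] to [t], then [s] and
    [t] have the same image, so [s = t] by injectivity: the idempotents are
    the partial identities ([idempotent_graph]), which commute because their
    composition is intersection of domains.  Finally the shift by [1] on the
    interval from [1] to [n - 1] does not commute with its inverse, since the
    point [1] is in its domain but not in its image. *)

Section PartialTranslations.
Variables (R : realType) (n : nat).
Implicit Types (k d m s t u : R) (x y z : Mbar R n).

Definition graph x s t : Prop :=
  match x with
  | Zero => False
  | @Triplet _ _ k d m _ => k <= s <= m /\ t = s + d
  end.

Lemma Triplet_congr k d m k' d' m' (h : in_range n k d m)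
    (h' : in_range n k' d' m') :
  k = k' -> d = d' -> m = m' -> Triplet h = Triplet h'.
Proof.
move=> ek ed em; move: h h'; rewrite ek ed em => h h'.
by rewrite (bool_irrelevance h h').
Qed.

(** Evaluating both graphs at the endpoints of the two intervals recovers the
    endpoints and the shift. *)
Lemma graph_inj x y : (forall s t, graph x s t <-> graph y s t) -> x = y.
Proof.
have ends k d m (h : in_range n k d m) :
    graph (Triplet h) k (k + d) /\ graph (Triplet h) m (m + d).
  by case/and3P: (h) => _ km _; rewrite /= !lexx km.
case: x => [|k d m h]; case: y => [|k' d' m' h'] // E.
- by have [/E] := ends _ _ _ h'.
- by have [/E] := ends _ _ _ h.
have [/E[/andP[? ?] ?] /E[/andP[? ?] _]] := ends _ _ _ h.
have [/E[/andP[? ?] _] /E[/andP[? ?] _]] := ends _ _ _ h'.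
by apply: Triplet_congr; lra.
Qed.

Lemma graph_fun x s t t' : graph x s t -> graph x s t' -> t = t'.
Proof. by case: x => [|k d m h] //= [_ ->] [_ ->]. Qed.

Lemma graph_injective x s s' t : graph x s t -> graph x s' t -> s = s'.
Proof. by case: x => [|k d m h] //= [_ ->] [_ /addIr]. Qed.

(** The maximum and minimum in [Mbar_mul] cut out the points of the first
    interval that are shifted into the second one; the product is [Zero]
    exactly when there are none. *)
Lemma graph_mul x y s t :
  graph (Mbar_mul x y) s t <-> exists2 u, graph x s u & graph y u t.
Proof.
case: x => [|k d m h]; first by split=> // -[].
case: y => [|k' d' m' h']; first by split=> // -[].
have dom : (Num.max k (k' - d) <= s <= Num.min m (m' - d)) =
    (k <= s <= m) && (k' <= s + d <= m').
  by rewrite ge_max le_min lerBlDr lerBrDr andbACA.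
rewrite /Mbar_mul; case: decP => [hle|nle] /=.
- rewrite dom; split=> [[/andP[hx hy] ->]|[u [hx ->] [hy ->]]].
    by exists (s + d); rewrite // addrA.
  by rewrite hx hy addrA.
- split=> // -[u [hx eu] [hy _]]; apply: nle.
  move: dom; rewrite hx -eu hy => /andP[]; exact: le_trans.
Qed.

Lemma graph_tr x s t : graph (Mbar_tr x) s t <-> graph x t s.
Proof.
case: x => [|k d m h] //=.
by split=> -[/andP[? ?] ?]; (split; [apply/andP; split|]); lra.
Qed.

Lemma graph_one (hn : (2 <= n)%N) s t :
  graph (Mbar_one R hn) s t <-> 1 <= s <= n%:R /\ t = s.
Proof. by rewrite /= addr0. Qed.

Lemma graph_range x s t :
  graph x s t -> 1 <= s <= n%:R /\ 1 <= t <= n%:R.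
Proof.
case: x => [|k d m h] //= [/andP[? ?] ->]; case/and3P: h.
by rewrite minEle maxEle; case: ifP => ? ? _ ?; split; apply/andP; split; lra.
Qed.

Lemma Mbar_mulA : associative (@Mbar_mul R n).
Proof.
move=> x y z; apply: graph_inj => s t; split.
- move=> /graph_mul[u xu] /graph_mul[v uv vt]; apply/graph_mul.
  by exists v => //; apply/graph_mul; exists u.
- move=> /graph_mul[v] /graph_mul[u su uv] vt; apply/graph_mul.
  by exists u => //; apply/graph_mul; exists v.
Qed.

Lemma Mbar_mul_one (hn : (2 <= n)%N) :
  is_identity (@Mbar_mul R n) (Mbar_one R hn).
Proof.
split=> x; apply: graph_inj => s t; split.
- by move=> /graph_mul[u /graph_one[_ ->]].
- move=> xst; apply/graph_mul; exists s => //; apply/graph_one.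
  by have [] := graph_range xst.
- by move=> /graph_mul[u xsu /graph_one[_ ->]].
- move=> xst; apply/graph_mul; exists t => //; apply/graph_one.
  by have [] := graph_range xst.
Qed.

Lemma Mbar_mul_zero : is_zero (@Mbar_mul R n) Zero.
Proof. by split=> // -[]. Qed.

Lemma Mbar_trK : involutive (@Mbar_tr R n).
Proof. by move=> x; apply: graph_inj => s t; rewrite !graph_tr. Qed.

Lemma Mbar_mul_trK x : Mbar_mul (Mbar_mul x (Mbar_tr x)) x = x.
Proof.
apply: graph_inj => s t; split.
- move=> /graph_mul[s'] /graph_mul[u su /graph_tr us'].
  by rewrite (graph_injective su us').
- move=> st; apply/graph_mul; exists s => //.
  by apply/graph_mul; exists t => //; apply/graph_tr.
Qed.

Lemma inverse_tr x : inverse_of (@Mbar_mul R n) x (Mbar_tr x).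
Proof.
by split; [|rewrite -{2}(Mbar_trK x)]; exact: Mbar_mul_trK.
Qed.

(** Half of the uniqueness of inverses.  It uses one of the two inverse
    equations, so it applies again with [x] and [y] exchanged and yields the
    converse implication. *)
Lemma inverse_graph x y s t :
  Mbar_mul (Mbar_mul x y) x = x -> graph x s t -> graph y t s.
Proof.
move=> xyx st; move: (st); rewrite -{1}xyx.
move=> /graph_mul[s'] /graph_mul[u su us'] s't.
by rewrite (graph_fun st su) (graph_injective st s't).
Qed.

Lemma inverse_unique x : unique (inverse_of (@Mbar_mul R n) x) (Mbar_tr x).
Proof.
split=> [|y [xyx yxy]]; first exact: inverse_tr.
by apply: graph_inj => s t; rewrite graph_tr; split; exact: inverse_graph.
Qed.

Lemma idempotent_graph x : idempotents (@Mbar_mul R n) x <->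
  forall s t, graph x s t -> t = s.
Proof.
split=> [xx s t xst | diag].
(* [s] reaches [t] in two steps through [u]; single-valuedness gives [u = t],
   so [x] sends both [s] and [t] to [t]. *)
- move: (xst); rewrite -{1}xx => /graph_mul[u su ut].
  by move: ut; rewrite -(graph_fun xst su) => /graph_injective; apply.
- apply: graph_inj => s t; split=> [/graph_mul[u su ut]|st].
    by rewrite -(diag _ _ su).
  apply/graph_mul; exists s => //.
  by have := st; rewrite (diag _ _ st).
Qed.

Lemma idempotents_semilattice :
  is_semilattice_on (@Mbar_mul R n) (idempotents (@Mbar_mul R n)).
Proof.
have swap x y s t : idempotents (@Mbar_mul R n) x ->
    idempotents (@Mbar_mul R n) y ->
    graph (Mbar_mul x y) s t -> graph (Mbar_mul y x) s t.
  move=> /idempotent_graph ex /idempotent_graph ey /graph_mul[u su ut].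
  apply/graph_mul; exists s.
    by have := ut; rewrite (ey _ _ ut) (ex _ _ su).
  by have := su; rewrite (ey _ _ ut) (ex _ _ su).
split=> [x y|x y z _ _ _|x y ex ey|x] //.
- move=> /idempotent_graph ex /idempotent_graph ey; apply/idempotent_graph.
  by move=> s t /graph_mul[u /ex <- /ey].
- exact: Mbar_mulA.
- by apply: graph_inj => s t; split; exact: swap.
Qed.

Lemma idempotentsE : idempotents (@Mbar_mul R n) =
  [set Zero] `|`
  [set x | exists (k m : R) (h : in_range n k 0 m), x = Triplet h].
Proof.
apply/seteqP; split=> x.
- case: x => [|k d m h] /idempotent_graph diag; first by left.
  right; have d0 : d = 0.
    apply: (@addrI _ k); rewrite addr0; apply: diag.
    by case/and3P: (h) => _ km _; rewrite /= lexx km.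
  by subst d; exists k, m, h.
- case=> [->|[k [m [h ->]]]]; apply/idempotent_graph => s t //=.
  by rewrite addr0 => -[].
Qed.

Lemma Mbar_mul_noncomm : (2 <= n)%N -> ~ commutative (@Mbar_mul R n).
Proof.
move=> hn comm.
have n2 : 2 <= n%:R :> R by rewrite ler_nat.
have shift_range : in_range n (1 : R) 1 (n%:R - 1).
  by rewrite /in_range min_l ?max_r ?ler01 // subr0 !lexx andbT /=; lra.
pose x := Triplet shift_range.
have : graph (Mbar_mul x (Mbar_tr x)) 1 1.
  have x12 : graph x 1 (1 + 1) by split=> //; rewrite lexx; lra.
  by apply/graph_mul; exists (1 + 1); [|apply/graph_tr].
by rewrite comm => /graph_mul[u /graph_tr /= [/andP[? ?] ?] _]; lra.
Qed.

End PartialTranslations.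

Theorem proposition1 (R : realType) (n : nat) (hn : (2 <= n)%N) :
  let mul := @Mbar_mul R n in
  [/\ [/\ is_monoid mul (Mbar_one R hn),
          is_zero mul Zero,
          is_inverse_semigroup mul
        & ~ commutative mul],
      forall x : Mbar R n, unique (inverse_of mul x) (Mbar_tr x),
      is_semilattice_on mul (idempotents mul)
    & idempotents mul =
        [set Zero] `|`
        [set x | exists (k m : R) (h : in_range n k 0 m), x = Triplet h]].
Proof.
move=> mul; split.
- split.
  + by split; [exact: Mbar_mulA | exact: Mbar_mul_one].
  + exact: Mbar_mul_zero.
  + split; first exact: Mbar_mulA.
    by move=> x; exists (Mbar_tr x); exact: inverse_unique.
  + exact: Mbar_mul_noncomm.
- exact: inverse_unique.
- exact: idempotents_semilattice.
- exact: idempotentsE.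
Qed.
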